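(* Let $f\colon\mathbb{R}^{m\times n}\to\mathbb{R}$ be continuously differentiable and $g\colon\mathcal{M}\to\mathbb{R}$, $g(X,P)=f(X)$. Let $(X,P)\in\mathcal{M}$ have representation $(U,\Sigma,V)$. Then the Riemannian gradient $\nabla g(X,P)$ is the tangent vector at $(X,P)$ with representation $$K=\nabla f(X)V\qquad\text{and}\qquad V_p=P\,\nabla f(X)^\top U\Sigma\,S(\alpha)^{-1},$$ where $S(\alpha)=2\alpha I_r+\Sigma^2$ and $\nabla f$ is the Euclidean gradient of $f$.
   Context: Let $m,n,r$ be positive integers with $r<\min(m,n)$. $\mathrm{Sym}(n)$: real symmetric $n\times n$ matrices; $\mathrm{St}(n,r)=\{V\in\mathbb{R}^{n\times r}:V^\top V=I_r\}$; $\mathrm{Gr}(n,n-r)=\{P\in\mathrm{Sym}(n):P^2=P,\ \mathrm{rank}\,P=n-r\}$. The desingularization $\mathcal{M}=\{(X,P)\in\mathbb{R}^{m\times n}\times\mathrm{Gr}(n,n-r):XP=0\}$ is a smooth embedded submanifold of $\mathcal{E}=\mathbb{R}^{m\times n}\times\mathrm{Sym}(n)$ of dimension $(m+n-r)r$. A representation of $(X,P)\in\mathcal{M}$ is a triplet $(U,\Sigma,V)$ with $U\in\mathrm{St}(m,r)$, $V\in\mathrm{St}(n,r)$, $\Sigma\in\mathbb{R}^{r\times r}$ diagonal with nonnegative, non-increasing diagonal entries, such that $X=U\Sigma V^\top$ and $P=I-VV^\top$ (one always exists). Given it, a representation of $(\dot X,\dot P)\in\mathrm{T}_{(X,P)}\mathcal{M}$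 is the (unique) pair $(K,V_p)\in\mathbb{R}^{m\times r}\times\mathbb{R}^{n\times r}$ with $V_p^\top V=0$, $\dot X=KV^\top+U\Sigma V_p^\top$, $\dot P=-V_pV^\top-VV_p^\top$; all tangent vectors, and only they, are of this form. $\mathcal{M}$ is a Riemannian submanifold of $\mathcal{E}$ with inner product $\langle(Y_1,Z_1),(Y_2,Z_2)\rangle=\langle Y_1,Y_2\rangle+\alpha\langle Z_1,Z_2\rangle$, $\alpha>0$ fixed (Frobenius inner products on the right). *)

(* Defs.v *)
From HB Require Import structures.
From mathcomp Require Import all_boot all_order all_algebra.
From mathcomp Require Import all_classical all_reals all_analysis.

Set Implicit Arguments.
Unset Strict Implicit.
Unset Printing Implicit Defensive.

Import Order.TTheory GRing.Theory Num.Theory numFieldNormedType.Exports.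

Local Open Scope classical_set_scope.
Local Open Scope ring_scope.

Section Euclidean.
Variables (R : realType) (m n : nat).

Definition frob (A B : 'M[R]_(m, n)) : R := \tr (A^T *m B).

(* A linear form has exactly one Frobenius representative (see egradP), so
   [get] never falls back on its default value. *)
Definition egrad (f : 'M[R]_(m, n) -> R) (X : 'M[R]_(m, n)) : 'M[R]_(m, n) :=
  get [set G | forall H, 'd f X H = frob G H].

Definition continuously_differentiable (f : 'M[R]_(m, n) -> R) : Prop :=
  (forall X, differentiable f X) /\ continuous (egrad f).

Lemma frob_sum (A B : 'M[R]_(m, n)) :
  frob A B = \sum_i \sum_j A i j * B i j.
Proof.
rewrite /frob /mxtrace exchange_big /=; apply: eq_bigr => j _.
by rewrite !mxE; apply: eq_bigr => i _; rewrite !mxE.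
Qed.

Lemma egradP (f : 'M[R]_(m, n) -> R) X H : 'd f X H = frob (egrad f X) H.
Proof.
suff : [set G | forall H, 'd f X H = frob G H] (egrad f X) by move=> ->.
apply: getPex; exists (\matrix_(i, j) 'd f X (delta_mx i j)) => {}H.
rewrite frob_sum {1}(matrix_sum_delta H) linear_sum; apply: eq_bigr => i _.
rewrite linear_sum; apply: eq_bigr => j _.
by rewrite mxE linearZ mulrC.
Qed.

End Euclidean.

Section Desingularization.
Variables (R : realType) (m n r : nat).

(* Pairs (Y, Z) with Z an arbitrary square matrix; the symmetry of Z is imposed
   by [desing] on points, and holds automatically for velocities of curves in
   [desing]. *)
Local Notation E := ('M[R]_(m, n) * 'M[R]_n)%type.

Definition stiefel (p q : nat) : set 'M[R]_(p, q) :=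
  [set V | V^T *m V = 1%:M].

Definition grassmann (k : nat) : set 'M[R]_n :=
  [set P | [/\ P^T = P, P *m P = P & \rank P = k]].

Definition desing : set E :=
  [set x | grassmann (n - r) x.2 /\ x.1 *m x.2 = 0].

Definition inner (alpha : R) (x y : E) : R :=
  frob x.1 y.1 + alpha * frob x.2 y.2.

Definition smooth_curve_on (M : set E) (c : R -> E) : Prop :=
  exists2 e : R, 0 < e &
    forall t, `|t| < e -> M (c t) /\ forall k : nat, derivable (derive1n k c) t 1.

Definition tangent_space (M : set E) (x : E) : set E :=
  [set xi | exists c : R -> E,
     [/\ smooth_curve_on M c, c 0 = x & derive1 c 0 = xi]].

(* The equation <G, c'(0)> = (g o c)'(0) reads <G, xi> = Dg(x)[xi].  Only the
   restriction of g to M matters, as curves stay in M near 0. *)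
Definition is_riemannian_gradient (alpha : R) (M : set E) (g : E -> R)
    (x G : E) : Prop :=
  tangent_space M x G /\
  forall c : R -> E, smooth_curve_on M c -> c 0 = x ->
    is_derive (0 : R) 1 (g \o c) (inner alpha G (derive1 c 0)).

Definition point_representation (x : E)
    (U : 'M[R]_(m, r)) (Sigma : 'M[R]_r) (V : 'M[R]_(n, r)) : Prop :=
  [/\ stiefel U, stiefel V,
      [/\ is_diag_mx Sigma,
          forall i, 0 <= Sigma i i &
          forall i j : 'I_r, (i <= j)%N -> Sigma j j <= Sigma i i],
      x.1 = U *m Sigma *m V^T &
      x.2 = 1%:M - V *m V^T].

Definition tangent_representation
    (U : 'M[R]_(m, r)) (Sigma : 'M[R]_r) (V : 'M[R]_(n, r))
    (K : 'M[R]_(m, r)) (Vp : 'M[R]_(n, r)) (xi : E) : Prop :=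
  [/\ Vp^T *m V = 0,
      xi.1 = K *m V^T + U *m Sigma *m Vp^T &
      xi.2 = - (Vp *m V^T) - V *m Vp^T].

Definition Salpha (alpha : R) (Sigma : 'M[R]_r) : 'M[R]_r :=
  (2 * alpha) *: 1%:M + Sigma *m Sigma.

End Desingularization.

Arguments desing {R} m n r.

(* Main.v *)
(** Differentiating [X P = 0], [P P = P] and [P^T = P] along a curve in the
desingularization shows that its velocity [(dX, dP)] is represented by
[K = dX V] and [Vp = - dP V].  Conversely, with [W t = V + t Vp] and [Q t] the
orthogonal projector onto the complement of the range of [W t], the curve
[((X + t dX) (1 - Q t), Q t)] stays in the desingularization for all [t] and
has velocity [(dX, dP)]; its entries are rational functions of [t] without
poles, since [(W t)^T (W t) = 1 + t^2 Vp^T Vp] is positive definite, hence it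
is smooth.  In terms of representations the inner product reads
[<K, K'> + <Vp S(alpha), Vp'>], whereas the differential of [f] reads
[<F V, K'> + <P F^T U Sigma, Vp'>] with [F] the Euclidean gradient, and
comparing the two gives the formula. *)

Require Import Defs.
From HB Require Import structures.
From mathcomp Require Import all_boot all_order all_algebra.
From mathcomp Require Import all_classical all_reals all_analysis.
From mathcomp Require Import zify ring.

Set Implicit Arguments.
Unset Strict Implicit.
Unset Printing Implicit Defensive.

Import Order.TTheory GRing.Theory Num.Theory numFieldNormedType.Exports.

Local Open Scope classical_set_scope.
Local Open Scope ring_scope.

(** * Derivatives of vector- and matrix-valued functions *)

Lemma is_derive_comp (R : realType) (V W : normedModType R) (F : V -> W)
    (c : R -> V) (t : R) (dc : V) :
  is_derive t 1 c dc -> differentiable F (c t) ->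
  is_derive t 1 (F \o c) ('d F (c t) dc).
Proof.
move=> [/derivable1_diffP cd <-] Fd.
have Fcd : differentiable (F \o c) t by exact: differentiable_comp.
apply: DeriveDef; first exact/derivable1_diffP.
by rewrite !deriveE// diff_comp.
Qed.

Lemma is_derive_fst (R : realType) (V W : normedModType R) (c : R -> V * W)
    (t : R) (dc : V * W) :
  is_derive t 1 c dc -> is_derive t 1 (fun s => (c s).1) dc.1.
Proof.
move=> cd.
have fst_cont : continuous (fst : V * W -> V) by move=> x; exact: cvg_fst.
have fst_diff : differentiable (fst : V * W -> _) (c t).
  exact: linear_differentiable.
by have := is_derive_comp cd fst_diff; rewrite diff_lin.
Qed.

Lemma is_derive_snd (R : realType) (V W : normedModType R) (c : R -> V * W)
    (t : R) (dc : V * W) :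
  is_derive t 1 c dc -> is_derive t 1 (fun s => (c s).2) dc.2.
Proof.
move=> cd.
have snd_cont : continuous (snd : V * W -> W) by move=> x; exact: cvg_snd.
have snd_diff : differentiable (snd : V * W -> _) (c t).
  exact: linear_differentiable.
by have := is_derive_comp cd snd_diff; rewrite diff_lin.
Qed.

Lemma is_derive_mxP (R : realType) (V : normedModType R) (m n : nat)
    (A : V -> 'M[R]_(m, n)) (t v : V) (dA : 'M[R]_(m, n)) :
  is_derive t v A dA <->
  forall i j, is_derive t v (fun s => A s i j : R) (dA i j).
Proof.
split=> [[Ad <-] i j|Ad].
  apply: DeriveDef; first by move/derivable_mxP : Ad.
  by rewrite derive_mx// mxE.
have Ad' : derivable A t v by apply/derivable_mxP => i j; have [] := Ad i j.
apply: DeriveDef => //; rewrite derive_mx//.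
by apply/matrixP => i j; rewrite mxE; have [] := Ad i j.
Qed.

Lemma is_derive_mulmx (R : realType) (V : normedModType R) (m n p : nat)
    (A : V -> 'M[R]_(m, n)) (B : V -> 'M[R]_(n, p)) (t v : V)
    (dA : 'M[R]_(m, n)) (dB : 'M[R]_(n, p)) :
  is_derive t v A dA -> is_derive t v B dB ->
  is_derive t v (fun s => A s *m B s) (dA *m B t + A t *m dB).
Proof.
move=> /is_derive_mxP Ad /is_derive_mxP Bd; apply/is_derive_mxP => i j.
(* Each entry becomes a finite sum of products of scalar functions, to which the scalar sum and
   product rules apply. *)
rewrite (_ : (fun _ => _) =
    \sum_k (fun s => A s i k : R) * (fun s => B s k j : R)); last first.
  by apply/funext => s; rewrite mxE fct_sumE.
apply: is_derive_eq; rewrite !mxE -big_split /=; apply: eq_bigr => k _ /=.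
by rewrite addrC; congr (_ + _); exact: mulrC.
Qed.

Lemma is_derive_trmx (R : realType) (V : normedModType R) (m n : nat)
    (A : V -> 'M[R]_(m, n)) (t v : V) (dA : 'M[R]_(m, n)) :
  is_derive t v A dA -> is_derive t v (fun s => (A s)^T) dA^T.
Proof.
move=> /is_derive_mxP Ad; apply/is_derive_mxP => i j; rewrite mxE.
rewrite (_ : (fun _ => _) = (fun s => A s j i : R))//.
by apply/funext => s; rewrite mxE.
Qed.

Lemma is_derive_affine_mx (R : realType) (m n : nat) (A B : 'M[R]_(m, n))
    (t : R) : is_derive t 1 (fun s : R => A + s *: B) B.
Proof.
apply/is_derive_mxP => i j.
rewrite (_ : (fun _ => _) = horner ((A i j)%:P + (B i j) *: 'X)).
  by apply: is_derive_eq; rewrite derivD derivC derivZ derivX !hornerE.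
by apply/funext => s; rewrite !mxE !hornerE mulrC.
Qed.

(** Allows differentiating both sides of an identity known only near [a], such as the defining
    equations of a set along a curve that stays in it for small times. *)
Lemma near_eq_is_derive_unique (R : realType) (V W : normedModType R)
    (f g : V -> W) (a v : V) (df dg : W) :
  (\forall x \near a, f x = g x) ->
  is_derive a v f df -> is_derive a v g dg -> df = dg.
Proof.
by move=> fg [_ <-] [_ <-]; exact: near_eq_derive.
Qed.

(** * Velocities of curves in the desingularization *)

Lemma smooth_curve_on_near (R : realType) (m n : nat)
    (M : set ('M[R]_(m, n) * 'M[R]_n)) (c : R -> 'M[R]_(m, n) * 'M[R]_n) :
  smooth_curve_on M c -> \forall t \near (0 : R), M (c t).
Proof.
move=> [e e0 cM]; have := @nbhs0_lt R R^o e e0.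
by apply: filterS => t /cM[].
Qed.

Lemma smooth_curve_on_is_derive (R : realType) (m n : nat)
    (M : set ('M[R]_(m, n) * 'M[R]_n)) (c : R -> 'M[R]_(m, n) * 'M[R]_n) :
  smooth_curve_on M c -> is_derive (0 : R) 1 c (derive1 c 0).
Proof.
move=> [e e0 cM]; rewrite derive1E; apply/derivableP.
by have [_ /(_ 0)] := cM 0 ltac:(by rewrite normr0).
Qed.

Lemma desing_curve_velocity (R : realType) (m n r : nat)
    (c : R -> 'M[R]_(m, n) * 'M[R]_n) (X : 'M[R]_(m, n)) (P : 'M[R]_n)
    (dX : 'M[R]_(m, n)) (dP : 'M[R]_n) :
  smooth_curve_on (desing m n r) c -> c 0 = (X, P) -> derive1 c 0 = (dX, dP) ->
  [/\ dX *m P + X *m dP = 0, dP *m P + P *m dP = dP & dP^T = dP].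
Proof.
move=> cM c0 cd; have cM' := smooth_curve_on_near cM.
have := smooth_curve_on_is_derive cM; rewrite cd => cder.
have Xd := is_derive_fst cder; have Pd := is_derive_snd cder.
rewrite /= in Xd Pd; split.
- have := is_derive_mulmx Xd Pd; rewrite c0 => XPd.
  apply: (near_eq_is_derive_unique _ XPd (is_derive_cst 0 _ _)).
  by apply: filterS cM' => t [].
- have := is_derive_mulmx Pd Pd; rewrite c0 => PPd.
  apply: (near_eq_is_derive_unique _ PPd Pd).
  by apply: filterS cM' => t [[]].
- apply: (near_eq_is_derive_unique _ (is_derive_trmx Pd) Pd).
  by apply: filterS cM' => t [[]].
Qed.

(** * Rational functions without real poles *)

Definition rational_fun (R : realType) (h : R -> R) : Prop :=
  exists p q : {poly R},
    (forall t, q.[t] != 0) /\ h = (fun t => p.[t] / q.[t]).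

Section RationalFun.
Context {R : realType}.
Implicit Types g h : R -> R.

Lemma rational_fun_horner (p : {poly R}) : rational_fun (horner p).
Proof.
exists p, 1; split=> [t|]; first by rewrite hornerC oner_eq0.
by apply/funext => t; rewrite hornerC divr1.
Qed.

Lemma rational_fun_cst (a : R) : rational_fun (fun=> a).
Proof.
have := rational_fun_horner a%:P.
by rewrite (_ : horner _ = (fun=> a))//; apply/funext => t; rewrite hornerC.
Qed.

Lemma rational_fun_id : rational_fun (@id R).
Proof.
have := rational_fun_horner 'X.
by rewrite (_ : horner _ = id)//; apply/funext => t; rewrite hornerX.
Qed.

Lemma rational_funD g h :
  rational_fun g -> rational_fun h -> rational_fun (fun t => g t + h t).
Proof.
move=> [p [q [q0 ->]]] [p' [q' [q'0 ->]]].
exists (p * q' + p' * q), (q * q'); split=> [t|].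
  by rewrite hornerM mulf_neq0.
by apply/funext => t; rewrite hornerD !hornerM addf_div.
Qed.

Lemma rational_funM g h :
  rational_fun g -> rational_fun h -> rational_fun (fun t => g t * h t).
Proof.
move=> [p [q [q0 ->]]] [p' [q' [q'0 ->]]].
exists (p * p'), (q * q'); split=> [t|]; first by rewrite hornerM mulf_neq0.
by apply/funext => t; rewrite !hornerM mulf_div.
Qed.

Lemma rational_funV h :
  (forall t, h t != 0) -> rational_fun h -> rational_fun (fun t => (h t)^-1).
Proof.
move=> h0 [p [q [q0 hE]]]; exists q, p; split=> [t|].
  by have := h0 t; rewrite hE mulf_eq0 negb_or => /andP[].
by apply/funext => t; rewrite hE invf_div.
Qed.

Lemma rational_fun_sum (I : Type) (s : seq I) (F : I -> R -> R) :
  (forall i, rational_fun (F i)) -> rational_fun (fun t => \sum_(i <- s) F i t).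
Proof.
move=> Frat; elim: s => [|i s IHs].
  under eq_fun do rewrite big_nil.
  exact: rational_fun_cst.
under eq_fun do rewrite big_cons.
exact: rational_funD.
Qed.

Lemma rational_fun_prod (I : Type) (s : seq I) (F : I -> R -> R) :
  (forall i, rational_fun (F i)) ->
  rational_fun (fun t => \prod_(i <- s) F i t).
Proof.
move=> Frat; elim: s => [|i s IHs].
  under eq_fun do rewrite big_nil.
  exact: rational_fun_cst.
under eq_fun do rewrite big_cons.
exact: rational_funM.
Qed.

(** The quotient rule has denominator [q ^+ 2], which again has no real root. The class is thus
    stable under derivation, and smoothness follows by iteration. *)
Lemma rational_fun_derive1 h :
  rational_fun h -> (forall t, derivable h t 1) /\ rational_fun (derive1 h).
Proof.
move=> [p [q [q0 ->]]].
have pd t : derivable (horner p) t 1 by exact: derivable_horner.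
have qd t : derivable (fun s => (q.[s])^-1) t 1.
  exact/derivableV/derivable_horner.
split=> [t|]; first exact: derivableM.
exists (p^`() * q - p * q^`()), (q ^+ 2); split=> [t|].
  by rewrite horner_exp expf_neq0.
apply/funext => t; rewrite derive1E deriveM// deriveV//.
rewrite -!derive1E -!derivE hornerD hornerN !hornerM.
rewrite /GRing.scale /=; field.
exact: q0.
Qed.

End RationalFun.

(** * Matrices with rational entries *)

Definition rational_mx (R : realType) (m n : nat) (A : R -> 'M[R]_(m, n)) :
    Prop := forall i j, rational_fun (fun t => A t i j).

Section RationalMx.
Context {R : realType}.

Lemma rational_mx_cst (m n : nat) (A : 'M[R]_(m, n)) : rational_mx (fun=> A).
Proof. by move=> i j; exact: rational_fun_cst. Qed.

Lemma rational_mxD (m n : nat) (A B : R -> 'M[R]_(m, n)) :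
  rational_mx A -> rational_mx B -> rational_mx (fun t => A t + B t).
Proof.
move=> Arat Brat i j; under eq_fun do rewrite mxE.
exact: rational_funD.
Qed.

Lemma rational_mxZ (m n : nat) (h : R -> R) (A : R -> 'M[R]_(m, n)) :
  rational_fun h -> rational_mx A -> rational_mx (fun t => h t *: A t).
Proof.
move=> hrat Arat i j; under eq_fun do rewrite mxE.
exact: rational_funM.
Qed.

Lemma rational_mxN (m n : nat) (A : R -> 'M[R]_(m, n)) :
  rational_mx A -> rational_mx (fun t => - A t).
Proof.
move=> Arat; under eq_fun do rewrite -scaleN1r.
by apply: rational_mxZ => //; exact: rational_fun_cst.
Qed.

Lemma rational_mxM (m n p : nat) (A : R -> 'M[R]_(m, n))
    (B : R -> 'M[R]_(n, p)) :
  rational_mx A -> rational_mx B -> rational_mx (fun t => A t *m B t).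
Proof.
move=> Arat Brat i j; under eq_fun do rewrite mxE.
by apply: rational_fun_sum => k; exact: rational_funM.
Qed.

Lemma rational_mx_tr (m n : nat) (A : R -> 'M[R]_(m, n)) :
  rational_mx A -> rational_mx (fun t => (A t)^T).
Proof. by move=> Arat i j; under eq_fun do rewrite mxE. Qed.

(** The Leibniz formula expresses the determinant as a signed sum of products of entries. *)
Lemma rational_fun_det (n : nat) (A : R -> 'M[R]_n) :
  rational_mx A -> rational_fun (fun t => \det (A t)).
Proof.
move=> Arat; apply: rational_fun_sum => s; apply: rational_funM.
  exact: rational_fun_cst.
exact: rational_fun_prod.
Qed.

(** By Cramer's rule the inverse is the adjugate divided by the determinant, which vanishes
    nowhere. *)
Lemma rational_mx_inv (n : nat) (A : R -> 'M[R]_n) :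
  (forall t, A t \in unitmx) -> rational_mx A ->
  rational_mx (fun t => invmx (A t)).
Proof.
move=> Aunit Arat.
(* [invmx] returns its argument on singular matrices; invertibility at every [t] selects the
   adjugate branch throughout. *)
under eq_fun do rewrite /invmx Aunit.
apply: rational_mxZ.
  apply: rational_funV; last exact: rational_fun_det.
  by move=> t; have := Aunit t; rewrite unitmxE unitfE.
(* Adjugate entries are cofactors: a constant sign times the determinant of a submatrix. *)
move=> i j; under eq_fun do rewrite mxE.
apply: rational_funM; first exact: rational_fun_cst.
apply: rational_fun_det => k l.
by under eq_fun do rewrite !mxE.
Qed.

Lemma rational_mx_derive1 (m n : nat) (A : R -> 'M[R]_(m, n)) :
  rational_mx A -> (forall t, derivable A t 1) /\ rational_mx (derive1 A).
Proof.
move=> Arat; have Ad t : derivable A t 1.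
  by apply/derivable_mxP => i j; have [] := rational_fun_derive1 (Arat i j).
split=> // i j.
rewrite (_ : (fun _ => _) = derive1 (fun t => A t i j)).
  by have [] := rational_fun_derive1 (Arat i j).
by apply/funext => t; rewrite !derive1E derive_mx// mxE.
Qed.

(** Induction on [k] for all curves at once: the derivative of a curve with rational components is a
    curve of the same kind. *)
Lemma rational_pair_derivable (m n p q : nat)
    (c : R -> 'M[R]_(m, n) * 'M[R]_(p, q)) :
  rational_mx (fun t => (c t).1) -> rational_mx (fun t => (c t).2) ->
  forall (k : nat) (t : R), derivable (derive1n k c) t 1.
Proof.
move=> c1 c2 k; elim: k c c1 c2 => [|k IHk] c c1 c2.
all: have [d1 d1'] := rational_mx_derive1 c1.
all: have [d2 d2'] := rational_mx_derive1 c2.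
all: have cd t : derivable c t 1
  by rewrite (_ : c = fun s => ((c s).1, (c s).2));
    [apply/derivable1_diffP/differentiable_pair; exact/derivable1_diffP
    |apply/funext => s; case: (c s)].
- by rewrite derive1n0.
- rewrite derive1Sn; apply: IHk.
  + rewrite (_ : (fun _ => _) = derive1 (fun t => (c t).1))//.
    apply/funext => t; rewrite !derive1E.
    by have [] := is_derive_fst (derivableP (cd t)).
  + rewrite (_ : (fun _ => _) = derive1 (fun t => (c t).2))//.
    apply/funext => t; rewrite !derive1E.
    by have [] := is_derive_snd (derivableP (cd t)).
Qed.

End RationalMx.

(** * The Frobenius product and positive definite matrices *)

Section Frobenius.
Context {R : realType}.

Lemma frobDl (m n : nat) (A B C : 'M[R]_(m, n)) :
  frob (A + B) C = frob A C + frob B C.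
Proof. by rewrite /frob linearD /= mulmxDl mxtraceD. Qed.

Lemma frobDr (m n : nat) (A B C : 'M[R]_(m, n)) :
  frob A (B + C) = frob A B + frob A C.
Proof. by rewrite /frob mulmxDr mxtraceD. Qed.

Lemma frobNl (m n : nat) (A B : 'M[R]_(m, n)) : frob (- A) B = - frob A B.
Proof. by rewrite /frob linearN /= mulNmx linearN. Qed.

Lemma frobNr (m n : nat) (A B : 'M[R]_(m, n)) : frob A (- B) = - frob A B.
Proof. by rewrite /frob mulmxN linearN. Qed.

Lemma frob_ge0 (m n : nat) (A : 'M[R]_(m, n)) : 0 <= frob A A.
Proof.
rewrite frob_sum; apply: sumr_ge0 => i _; apply: sumr_ge0 => j _.
by rewrite -expr2 sqr_ge0.
Qed.

Lemma frob_eq0 (m n : nat) (A : 'M[R]_(m, n)) : frob A A = 0 -> A = 0.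
Proof.
rewrite frob_sum => /eqP A0; apply/matrixP => i j; rewrite mxE; apply/eqP.
move: A0; rewrite psumr_eq0 => [|k _]; last first.
  by apply: sumr_ge0 => l _; rewrite -expr2 sqr_ge0.
move=> /allP /(_ i (mem_index_enum _)) /=.
rewrite psumr_eq0 => [|k _]; last by rewrite -expr2 sqr_ge0.
by move=> /allP /(_ j (mem_index_enum _)) /=; rewrite mulf_eq0 orbb.
Qed.

(** Cyclicity of the trace brings [A^T *m C] and [E^T *m B] together, so that relations such as
    [V^T *m V = 1%:M] and [Vp^T *m V = 0] can be substituted. *)
Lemma frob_mulmx_tr (m n p q : nat) (A : 'M[R]_(m, p)) (B : 'M[R]_(n, p))
    (C : 'M[R]_(m, q)) (E : 'M[R]_(n, q)) :
  frob (A *m B^T) (C *m E^T) = \tr ((A^T *m C) *m (E^T *m B)).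
Proof.
by rewrite /frob trmx_mul trmxK -!mulmxA [LHS]mxtrace_mulC !mulmxA.
Qed.

(** A row vector [v] in the kernel would satisfy [a |v|^2 + |B v^T|^2 = 0], hence vanish. This
    serves both for the Gram matrix of [V + t Vp] and for [Salpha]. *)
Lemma scalar_add_gram_unitmx (m n : nat) (a : R) (B : 'M[R]_(m, n)) :
  0 < a -> a *: 1%:M + B^T *m B \in unitmx.
Proof.
move=> a0; rewrite unitmxE unitfE; apply/det0P => -[v v0 vB].
have /eqP : \tr (v *m (a *: 1%:M + B^T *m B) *m v^T) = 0.
  by rewrite vB mul0mx mxtrace0.
have -> : \tr (v *m (a *: 1%:M + B^T *m B) *m v^T) =
    a * frob v^T v^T + frob (B *m v^T) (B *m v^T).
  rewrite mulmxDr mulmxDl mxtraceD -scalemxAr -scalemxAl mulmx1 mxtraceZ.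
  by rewrite /frob trmx_mul !trmxK !mulmxA.
rewrite paddr_eq0 ?frob_ge0 ?mulr_ge0 ?frob_ge0 ?ltW//.
rewrite mulf_eq0 gt_eqF//= => /andP[/eqP/frob_eq0 vT0 _].
by move: v0; rewrite -[v]trmxK vT0 trmx0 eqxx.
Qed.

End Frobenius.

(** * The orthogonal projector onto the complement of the range of a matrix of full column rank *)

Definition ortho_proj (R : realType) (n r : nat) (W : 'M[R]_(n, r)) : 'M[R]_n :=
  1%:M - W *m invmx (W^T *m W) *m W^T.

Lemma ortho_proj_mulmx (R : realType) (n r : nat) (W : 'M[R]_(n, r)) :
  W^T *m W \in unitmx -> ortho_proj W *m W = 0.
Proof.
move=> Wu; rewrite /ortho_proj mulmxBl mul1mx -!mulmxA.
by rewrite mulVmx// mulmx1 subrr.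
Qed.

Lemma grassmann_ortho_proj (R : realType) (n r : nat) (W : 'M[R]_(n, r)) :
  W^T *m W \in unitmx -> grassmann (n - r) (ortho_proj W).
Proof.
move=> Wu; have PW := ortho_proj_mulmx Wu; split.
- rewrite /ortho_proj linearB /= trmx1 !trmx_mul trmxK trmx_inv.
  by rewrite trmx_mul trmxK mulmxA.
- by rewrite {2}/ortho_proj mulmxBr mulmx1 !mulmxA PW !mul0mx subr0.
(* The rank is squeezed: [ortho_proj W *m W = 0] with [W] of rank at least [r] bounds it above by
   [n - r], and subadditivity of the rank on the splitting of the identity bounds it below. *)
have rankW : (r <= \rank W)%N.
  rewrite -{1}(mxrank1 R r) -(mulVmx Wu) mulmxA; exact: mxrankM_maxr.
have : (n <= \rank (ortho_proj W) + r)%N.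
  rewrite -{1}(mxrank1 R n) -(subrK (W *m invmx (W^T *m W) *m W^T) 1%:M).
  apply: leq_trans (mxrank_add _ _) _; rewrite leq_add2l.
  by apply: leq_trans (mxrankM_maxr _ _) (rank_leq_row _).
have := mulmx0_rank_max PW; move: rankW; lia.
Qed.

Lemma rational_ortho_proj (R : realType) (n r : nat) (W : R -> 'M[R]_(n, r)) :
  (forall t, (W t)^T *m W t \in unitmx) -> rational_mx W ->
  rational_mx (fun t => ortho_proj (W t)).
Proof.
move=> Wu Wrat; apply: rational_mxD; first exact: rational_mx_cst.
apply: rational_mxN; apply: rational_mxM; last exact: rational_mx_tr.
apply: rational_mxM => //; apply: rational_mx_inv => //.
by apply: rational_mxM => //; exact: rational_mx_tr.
Qed.

(** * Tangent vectors of the desingularization and their representations *)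

Section TangentSpace.
Context {R : realType} {m n r : nat}.
Variables (X : 'M[R]_(m, n)) (P : 'M[R]_n).
Variables (U : 'M[R]_(m, r)) (Sigma : 'M[R]_r) (V : 'M[R]_(n, r)).
Hypothesis XP_in : desing m n r (X, P).
Hypothesis XP_repr : point_representation (X, P) U Sigma V.

Lemma velocity_tangent_representation (c : R -> 'M[R]_(m, n) * 'M[R]_n)
    (dX : 'M[R]_(m, n)) (dP : 'M[R]_n) :
  smooth_curve_on (desing m n r) c -> c 0 = (X, P) -> derive1 c 0 = (dX, dP) ->
  tangent_representation U Sigma V (dX *m V) (- (dP *m V)) (dX, dP).
Proof.
move=> cM c0 cd; have [XP PP PT] := desing_curve_velocity cM c0 cd.
have [_ VV _ /= XE PE] := XP_repr.
have PV : P *m V = 0 by rewrite PE mulmxBl mul1mx -mulmxA VV mulmx1 subrr.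
have VP : V^T *m P = 0 by rewrite PE mulmxBr mulmx1 mulmxA VV mul1mx subrr.
(* Compressing [dP *m P + P *m dP = dP] by [V] on both sides kills the left-hand side; this gives
   the orthogonality of [Vp] to [V]. *)
have VPV : V^T *m dP *m V = 0.
  rewrite -PP mulmxDr mulmxDl !mulmxA VP !mul0mx addr0.
  by rewrite -mulmxA PV mulmx0.
have VVE : V *m V^T = 1%:M - P by rewrite PE opprB addrC subrK.
split=> /=.
- by rewrite linearN /= trmx_mul PT mulNmx VPV oppr0.
- rewrite linearN /= trmx_mul PT mulmxN mulmxA -XE -mulmxA VVE.
  by rewrite mulmxBr mulmx1 -addrA -opprD XP subr0.
- rewrite linearN /= trmx_mul PT mulNmx opprK mulmxN opprK.
  rewrite mulmxA VVE -mulmxA VVE.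
  by rewrite mulmxBr mulmxBl mulmx1 mul1mx addrACA -opprD PP addrK.
Qed.

Lemma tangent_representation_tangent_space (K : 'M[R]_(m, r))
    (Vp : 'M[R]_(n, r)) (xi : 'M[R]_(m, n) * 'M[R]_n) :
  tangent_representation U Sigma V K Vp xi ->
  tangent_space (desing m n r) (X, P) xi.
Proof.
case: xi => dX dP [VpV /= dXE dPE].
have [_ VV _ /= _ PE] := XP_repr.
have [_ /= XP] := XP_in.
have VVp : V^T *m Vp = 0 by rewrite -[LHS]trmxK trmx_mul trmxK VpV trmx0.
pose W t := V + t *: Vp.
(* The cross terms vanish because [Vp] is orthogonal to [V]. The factor [1] is kept to match the
   shape of [scalar_add_gram_unitmx]. *)
have WW t : (W t)^T *m W t = 1 *: 1%:M + (t *: Vp)^T *m (t *: Vp).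
  have -> : (W t)^T = V^T + t *: Vp^T by rewrite /W linearD linearZ.
  rewrite scale1r /W mulmxDl !mulmxDr VV.
  have -> : V^T *m (t *: Vp) = 0 by rewrite -scalemxAr VVp scaler0.
  have -> : (t *: Vp^T) *m V = 0 by rewrite -scalemxAl VpV scaler0.
  by rewrite addr0 add0r [(t *: Vp)^T]linearZ.
have Wu t : (W t)^T *m W t \in unitmx.
  by rewrite WW; exact: scalar_add_gram_unitmx.
pose Q t := ortho_proj (W t).
have QW t : Q t *m W t = 0 by exact: ortho_proj_mulmx.
(* The line [X + t dX] need not satisfy the constraint; multiplying by [1%:M - Q t] makes the
   product with [Q t] zero for every [t]. *)
pose c t := ((X + t *: dX) *m (1%:M - Q t), Q t).
have Wrat : rational_mx W.
  apply: rational_mxD; first exact: rational_mx_cst.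
  by apply: rational_mxZ; [exact: rational_fun_id|exact: rational_mx_cst].
have Qrat : rational_mx Q by exact: rational_ortho_proj.
have crat : rational_mx (fun t => (c t).1).
  apply: rational_mxM; apply: rational_mxD; try exact: rational_mx_cst.
    by apply: rational_mxZ; [exact: rational_fun_id|exact: rational_mx_cst].
  exact: rational_mxN.
have cM : smooth_curve_on (desing m n r) c.
  exists 1 => // t _; split; last by move=> k; exact: rational_pair_derivable.
  have QG : grassmann (n - r) (Q t) by exact: grassmann_ortho_proj.
  split=> //=; have [_ QQ _] := QG.
  by rewrite -mulmxA mulmxBl mul1mx QQ subrr mulmx0.
have W0 : W 0 = V by rewrite /W scale0r addr0.
have Q0 : Q 0 = P.
  by rewrite /Q /ortho_proj W0 VV invmx1 mulmx1 PE.
have c0 : c 0 = (X, P).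
  by rewrite /c Q0 scale0r addr0 mulmxBr mulmx1 XP subr0.
(* The velocity [(dY, dQ)] of [c] already has the representation [(dY V, - dQ V)], so only these two
   products remain to be identified with [K] and [Vp]. *)
exists c; split=> //; case cd : (derive1 c 0) => [dY dQ].
have [_ /= dYE dQE] := velocity_tangent_representation cM c0 cd.
have := smooth_curve_on_is_derive cM; rewrite cd => cder.
have Yd := is_derive_fst cder; have Qd := is_derive_snd cder.
rewrite /= -/(Q _) in Yd Qd.
have Wd : is_derive (0 : R) (1 : R) W Vp by exact: is_derive_affine_mx.
have PVp : P *m Vp = Vp by rewrite PE mulmxBl mul1mx -mulmxA VVp mulmx0 subr0.
(* [Q t W t = 0] and [(c t).1 W t = (X + t dX) W t] determine the velocity. *)
have dQV : dQ *m V = - Vp.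
  apply/eqP; rewrite -addr_eq0; apply/eqP.
  have := is_derive_mulmx Qd Wd; rewrite W0 Q0 PVp => QWd.
  have QW0 : (fun t => Q t *m W t) = cst 0 by exact/funext.
  by have [_ <-] := QWd; rewrite QW0 derive_cst.
have dYV : dY *m V = K.
  have := is_derive_mulmx Yd Wd; rewrite Q0 W0 scale0r addr0 => YWd.
  have := is_derive_mulmx (is_derive_affine_mx X dX 0) Wd.
  rewrite W0 scale0r addr0 => XWd.
  have YWX : (fun t => (c t).1 *m W t) = (fun t => (X + t *: dX) *m W t).
    by apply/funext => t; rewrite /= -mulmxA mulmxBl mul1mx QW subr0.
  rewrite [Z in is_derive _ _ Z _]YWX in YWd.
  have [_] := YWd; have [_ ->] := XWd.
  (* Since [X *m P = 0], both derivatives contain the same term [X *m Vp]; cancelling it leaves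
     [dY *m V = dX *m V], which equals [K]. *)
  rewrite mulmxBr mulmx1 XP subr0 => /addIr <-.
  by rewrite dXE mulmxDl -!mulmxA VV VpV !mulmx0 mulmx1 addr0.
rewrite dYV dQV opprK in dYE; rewrite dQV opprK in dQE.
by rewrite dYE dQE dXE dPE.
Qed.

End TangentSpace.

(** * Inner products and differentials in terms of representations *)

Section RepresentationPairing.
Context {R : realType} {m n r : nat}.
Variables (U : 'M[R]_(m, r)) (Sigma : 'M[R]_r) (V : 'M[R]_(n, r)).
Hypothesis UU : stiefel U.
Hypothesis VV : stiefel V.
Hypothesis SigmaT : Sigma^T = Sigma.

(** Mixed terms vanish by orthogonality to [V]. The two halves of the projector component contribute
    equally, giving [2 * alpha], while [U *m Sigma *m Vp^T] contributes [Sigma *m Sigma]; together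
    they form [Salpha]. *)
Lemma inner_tangent_representation (alpha : R) (K K' : 'M[R]_(m, r))
    (Vp Vp' : 'M[R]_(n, r)) (xi xi' : 'M[R]_(m, n) * 'M[R]_n) :
  tangent_representation U Sigma V K Vp xi ->
  tangent_representation U Sigma V K' Vp' xi' ->
  inner alpha xi xi' = frob K K' + frob (Vp *m Salpha alpha Sigma) Vp'.
Proof.
move=> [VpV xi1 xi2] [Vp'V xi'1 xi'2].
have VVp : V^T *m Vp = 0 by rewrite -[LHS]trmxK trmx_mul trmxK VpV trmx0.
have trVp : \tr (Vp'^T *m Vp) = \tr (Vp^T *m Vp').
  by rewrite -mxtrace_tr trmx_mul trmxK.
have trSVp : \tr (Sigma *m Sigma *m (Vp'^T *m Vp)) =
    \tr (Sigma *m Sigma *m (Vp^T *m Vp')).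
  by rewrite -mxtrace_tr !trmx_mul trmxK SigmaT mxtrace_mulC.
rewrite /inner xi1 xi2 xi'1 xi'2 -!opprD frobNl frobNr opprK.
rewrite !frobDl !frobDr !frob_mulmx_tr VV VpV Vp'V VVp.
rewrite !(mulmx0, mul0mx, mxtrace0, mulmx1, mul1mx, addr0, add0r).
rewrite trmx_mul SigmaT.
rewrite -[Sigma *m U^T *m _]mulmxA (mulmxA U^T) UU mul1mx trSVp trVp.
rewrite /Salpha mulmxDr -scalemxAr mulmx1 frobDl.
rewrite /frob !trmx_mul SigmaT linearZ /= -scalemxAl mxtraceZ -!mulmxA.
by ring.
Qed.

(** The projector may be inserted freely because [Vp^T *m V = 0]. It makes the factor paired with
    [Vp] orthogonal to [V], as the second component of a tangent representation must be. *)
Lemma frob_tangent_representation (F : 'M[R]_(m, n)) (K : 'M[R]_(m, r))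
    (Vp : 'M[R]_(n, r)) (xi : 'M[R]_(m, n) * 'M[R]_n) :
  tangent_representation U Sigma V K Vp xi ->
  frob F xi.1 =
  frob (F *m V) K + frob ((1%:M - V *m V^T) *m F^T *m U *m Sigma) Vp.
Proof.
move=> [VpV -> _]; rewrite frobDr; congr (_ + _).
  by rewrite /frob mulmxA mxtrace_mulC mulmxA trmx_mul.
have VpP : Vp^T *m (1%:M - V *m V^T) = Vp^T.
  by rewrite mulmxBr mulmx1 mulmxA VpV mul0mx subr0.
rewrite /frob [RHS](esym (mxtrace_tr _)) trmx_mul trmxK !mulmxA VpP.
by rewrite mxtrace_mulC !mulmxA.
Qed.

End RepresentationPairing.

(** * Uniqueness and formula of the Riemannian gradient *)

Lemma inner_eq0 (R : realType) (m n : nat) (alpha : R)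
    (x : 'M[R]_(m, n) * 'M[R]_n) :
  0 < alpha -> inner alpha x x = 0 -> x = 0.
Proof.
move=> a0 /eqP; rewrite /inner paddr_eq0; last 2 first.
- exact: frob_ge0.
- by rewrite mulr_ge0 ?frob_ge0// ltW.
rewrite mulf_eq0 (gt_eqF a0) /= => /andP[/eqP/frob_eq0 x1 /eqP/frob_eq0 x2].
by rewrite [x]surjective_pairing x1 x2.
Qed.

Lemma innerBl (R : realType) (m n : nat) (alpha : R)
    (x y z : 'M[R]_(m, n) * 'M[R]_n) :
  inner alpha (x - y) z = inner alpha x z - inner alpha y z.
Proof. by rewrite /inner /= !frobDl !frobNl mulrDr mulrN opprD addrACA. Qed.

Lemma innerBr (R : realType) (m n : nat) (alpha : R)
    (x y z : 'M[R]_(m, n) * 'M[R]_n) :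
  inner alpha x (y - z) = inner alpha x y - inner alpha x z.
Proof. by rewrite /inner /= !frobDr !frobNr mulrDr mulrN opprD addrACA. Qed.

(* The difference of two gradients is orthogonal to every velocity, and both
   gradients are themselves velocities. *)
Lemma is_riemannian_gradient_unique (R : realType) (m n : nat) (alpha : R)
    (M : set ('M[R]_(m, n) * 'M[R]_n)) (g : 'M[R]_(m, n) * 'M[R]_n -> R)
    (x G H : 'M[R]_(m, n) * 'M[R]_n) :
  0 < alpha -> is_riemannian_gradient alpha M g x G ->
  is_riemannian_gradient alpha M g x H -> G = H.
Proof.
move=> a0 [TG gG] [TH gH]; apply/eqP; rewrite -subr_eq0; apply/eqP.
have ortho z : tangent_space M x z -> inner alpha (G - H) z = 0.
  move=> [c [cM c0 <-]]; rewrite innerBl.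
  by have [_ <-] := gG c cM c0; have [_ <-] := gH c cM c0; rewrite subrr.
by apply: (inner_eq0 a0); rewrite innerBr !ortho// subrr.
Qed.

Theorem proposition3p5 (R : realType) (m n r : nat)
    (r_gt0 : (0 < r)%N) (r_lt : (r < minn m n)%N)
    (alpha : R) (alpha_gt0 : 0 < alpha)
    (f : 'M[R]_(m, n) -> R) (f_C1 : continuously_differentiable f)
    (g : 'M[R]_(m, n) * 'M[R]_n -> R)
    (g_def : forall X P, desing m n r (X, P) -> g (X, P) = f X)
    (X : 'M[R]_(m, n)) (P : 'M[R]_n) (XP_in : desing m n r (X, P))
    (U : 'M[R]_(m, r)) (Sigma : 'M[R]_r) (V : 'M[R]_(n, r))
    (XP_repr : point_representation (X, P) U Sigma V) :
  exists2 G : 'M[R]_(m, n) * 'M[R]_n,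
    unique (is_riemannian_gradient alpha (desing m n r) g (X, P)) G &
    tangent_representation U Sigma V
      (egrad f X *m V)
      (P *m (egrad f X)^T *m U *m Sigma *m invmx (Salpha alpha Sigma))
      G.
Proof.
have [UU VV [Sdiag _ _] /= _ PE] := XP_repr.
have SigmaT : Sigma^T = Sigma.
  apply/matrixP => i j; rewrite mxE; have [->//|ij] := eqVneq i j.
  by rewrite !(is_diag_mxP Sdiag)// eq_sym.
have Su : Salpha alpha Sigma \in unitmx.
  (* As [Sigma] is symmetric, its square is a Gram matrix, and [2 * alpha] is positive. *)
  rewrite /Salpha -{1}SigmaT; apply: scalar_add_gram_unitmx.
  by rewrite mulr_gt0.
have PV : P *m V = 0 by rewrite PE mulmxBl mul1mx -mulmxA VV mulmx1 subrr.
have PT : P^T = P by have [[]] := XP_in.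
set K := egrad f X *m V; set Vp := P *m _ *m _ *m _ *m _.
pose G := (K *m V^T + U *m Sigma *m Vp^T, - (Vp *m V^T) - V *m Vp^T).
have Grepr : tangent_representation U Sigma V K Vp G.
  by split=> //; rewrite /Vp !trmx_mul PT -!mulmxA PV !mulmx0.
exists G => //.
have Ggrad : is_riemannian_gradient alpha (desing m n r) g (X, P) G.
  split; first exact: tangent_representation_tangent_space Grepr.
  move=> c cM c0; case cd : (derive1 c 0) => [dX dP].
  have crepr := velocity_tangent_representation XP_repr cM c0 cd.
  rewrite (inner_tangent_representation UU VV SigmaT _ Grepr crepr).
  (* The inverse in [Vp] cancels the factor [Salpha] of the inner product, leaving exactly the
     pairing of the Euclidean gradient with [dX]. *)
  rewrite /Vp mulmxKV// PE -(frob_tangent_representation _ crepr) /=.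
  rewrite -egradP.
  have := smooth_curve_on_is_derive cM; rewrite cd => /is_derive_fst /= Xd.
  have fd : differentiable f (c 0).1 by exact: f_C1.1.
  have := is_derive_comp Xd fd; rewrite c0 /=.
  (* For small times the curve lies in the desingularization, where [g] is [f] of the first
     component; the chain rule for [f] therefore gives the derivative of [g \o c]. *)
  apply: near_eq_is_derive; apply: filterS (smooth_curve_on_near cM) => t /=.
  by case: (c t) => Y Q /g_def.
by split=> // H; exact: is_riemannian_gradient_unique Ggrad.
Qed.
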